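(* Let $N,d\in\mathbb N$, let $W_1,W_2\in\mathbb R^{N\times N}$ be doubly stochastic matrices with consensus-contraction rates $\lambda_1,\lambda_2$ satisfying $0<\lambda_1,\lambda_2<1$, let $c_1,c_2>0$ be the per-round token costs of modes $1$ and $2$, let $\eta>0$ be a disagreement threshold and $\varepsilon>0$ a consensus tolerance. Let $(\mathbf X_k,b_k)_{k\ge0}$ be the trajectory of $$\mathbf X_{k+1}=W_{\sigma_k}\mathbf X_k,\qquad b_{k+1}=b_k-c_{\sigma_k},\qquad \sigma_k=\begin{cases}1,&D(\mathbf X_k)>\eta,\\ 2,&D(\mathbf X_k)\le\eta,\end{cases}$$ started at $(\mathbf X_0,b_0)\in\mathbb R^{N\times d}\times\mathbb R_{\ge0}$ with $b_0>0$. Let $$K^*=\left\lceil\frac{\log(\eta/D(\mathbf X_0))}{\log\lambda_1}\right\rceil+\left\lceil\frac{\log(\varepsilon/\eta)}{\log\lambda_2}\right\rceil .$$ If $(\mathbf X_0,b_0)\in\Omega_{\mathrm{cert}}$, then the corresponding trajectory reaches the $\varepsilon$-consensus safe set $\Omega_\varepsilon$ in at most $K^*$ communication rounds. Equivalently, $D(\mathbf X_{K^*})\le\varepsilon$ and $b_{K^*}\ge0$.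
   Context: A real matrix is doubly stochastic if its entries are nonnegative and every row and every column sums to $1$. Let $\mathbf 1\in\mathbb R^N$ be the all-ones column vector, $\mathbf 1^\perp=\{v\in\mathbb R^N:\mathbf 1^\top v=0\}$ and $P=I-\frac1N\mathbf 1\mathbf 1^\top$. For a doubly stochastic $W_\sigma$ (which maps $\mathbf 1^\perp$ into itself), the consensus-contraction rate is $\lambda_\sigma:=\|W_\sigma|_{\mathbf 1^\perp}\|_2$, i.e. the smallest constant with $\|W_\sigma v\|_2\le\lambda_\sigma\|v\|_2$ for all $v\in\mathbf 1^\perp$. The state $\mathbf X_k\in\mathbb R^{N\times d}$ has as rows the belief vectors of $N$ agents at communication round $k$, and $b_k$ is the remaining token budget at round $k$. The disagreement of $\mathbf X\in\mathbb R^{N\times d}$ is $D(\mathbf X)=\frac{1}{\sqrt N}\|P\mathbf X\|_F$ (Frobenius norm). The $\varepsilon$-consensus safe set is $$\Omega_\varepsilon=\{(\mathbf X,b)\in\mathbb R^{N\times d}\times\mathbb R_{\ge0}: D(\mathbf X)\le\varepsilon,\ b\ge0\}.$$ Let $$B^*(D)=\left\lceil\frac{\log(\eta/D)}{\log\lambda_1}\right\rceil c_1+\left\lceil\frac{\log(\varepsilon/\eta)}{\log\lambda_2}\right\rceil c_2 .$$ The consensus-budget certificate region is $$\Omega_{\mathrm{cert}}=\{(\mathbf X,b)\in\mathbb R^{N\times d}\times\mathbb R_{\ge0}: b\ge B^*(D(\mathbf X))\}.$$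
   Formalization: Negative ceilings in K* and B* count as 0 (with signed ceilings the claim fails, e.g. when D(X_0)<η), and b_{K*} ≥ 0 is claimed only when c_2 ≤ c_1 (it can fail otherwise); reaching Ω_ε within K* rounds and D(X_{K*}) ≤ ε hold without that condition. *)

(* Defs.v *)
From HB Require Import structures.
From mathcomp Require Import all_boot all_order all_algebra.
From mathcomp Require Import all_classical all_reals all_analysis.

Set Implicit Arguments.
Unset Strict Implicit.
Unset Printing Implicit Defensive.

Import Order.TTheory GRing.Theory Num.Theory.
Local Open Scope classical_set_scope.
Local Open Scope ring_scope.

Definition doubly_stochastic (R : realType) (N : nat) (W : 'M[R]_N) : Prop :=
  [/\ forall i j, 0 <= W i j,
      forall i, \sum_j W i j = 1
    & forall j, \sum_i W i j = 1].

(* On column vectors this is the Euclidean norm; the library's own norm on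
   matrices is the sup norm. *)
Definition frobenius (R : realType) (m n : nat) (A : 'M[R]_(m, n)) : R :=
  Num.sqrt (\sum_i \sum_j A i j ^+ 2).

Definition ones (R : realType) (N : nat) : 'cV[R]_N := const_mx 1.

Definition ones_orth (R : realType) (N : nat) : set 'cV[R]_N :=
  [set v | (ones R N)^T *m v = 0].

Definition centering (R : realType) (N : nat) : 'M[R]_N :=
  1%:M - N%:R^-1 *: (ones R N *m (ones R N)^T).

(* The operator 2-norm of W restricted to the orthogonal of the ones vector, as
   the smallest admissible constant.  Without the condition [0 <= l] the set
   would be unbounded below when that subspace is trivial. *)
Definition contraction_rate (R : realType) (N : nat) (W : 'M[R]_N) : R :=
  inf [set l : R | 0 <= l /\
    forall v : 'cV[R]_N, ones_orth v ->
      frobenius (W *m v) <= l * frobenius v].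

Definition disagreement (R : realType) (N d : nat) (X : 'M[R]_(N, d)) : R :=
  (Num.sqrt N%:R)^-1 * frobenius (centering R N *m X).

Inductive mode : Set := mode1 | mode2.

Definition switch (R : realType) (N d : nat) (eta : R) (X : 'M[R]_(N, d)) :
    mode :=
  if eta < disagreement X then mode1 else mode2.

(* Ceiling as a number of communication rounds: negative ceilings count as 0. *)
Definition nceil (R : realType) (x : R) : nat := absz (Num.max 0 (Num.ceil x)).

(* For D = 0 the conventions [eta / 0 = 0] and [ln 0 = 0] give 0 rounds, which
   is also the clamped value of the limit D -> 0+. *)
Definition rounds1 (R : realType) (lam : mode -> R) (eta D : R) : nat :=
  nceil (ln (eta / D) / ln (lam mode1)).

Definition rounds2 (R : realType) (lam : mode -> R) (eta eps : R) : nat :=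
  nceil (ln (eps / eta) / ln (lam mode2)).

Definition Kstar (R : realType) (lam : mode -> R) (eta eps D : R) : nat :=
  (rounds1 lam eta D + rounds2 lam eta eps)%N.

Definition Bstar (R : realType) (lam c : mode -> R) (eta eps D : R) : R :=
  (rounds1 lam eta D)%:R * c mode1 + (rounds2 lam eta eps)%:R * c mode2.

Definition safe_set (R : realType) (N d : nat) (eps : R) :
    set ('M[R]_(N, d) * R) :=
  [set s | disagreement s.1 <= eps /\ 0 <= s.2].

Definition certificate_region (R : realType) (N d : nat) (lam c : mode -> R)
    (eta eps : R) : set ('M[R]_(N, d) * R) :=
  [set s | 0 <= s.2 /\ Bstar lam c eta eps (disagreement s.1) <= s.2].

(* Main.v *)
(* The centering projection commutes with doubly stochastic matrices, so each
   round multiplies the disagreement by at most the rate of the active mode and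
   the disagreement never increases.  Hence the trajectory uses mode 1 for some
   m rounds, with m at most the first ceiling n1, and mode 2 forever after; n2
   further rounds, n2 the second ceiling, bring the disagreement below the
   tolerance at round m + n2, at cost m c1 + n2 c2.  The remaining n1 - m rounds
   until n1 + n2 are run in mode 2; when c2 <= c1 they cost no more than what the
   certificate reserves for mode 1. *)
Require Import Defs.
From HB Require Import structures.
From mathcomp Require Import all_boot all_order all_algebra.
From mathcomp Require Import all_classical all_reals all_analysis.

Import Order.TTheory GRing.Theory Num.Theory.
Local Open Scope classical_set_scope.
Local Open Scope ring_scope.

Lemma frobenius_ge0 (R : realType) (m n : nat) (A : 'M[R]_(m, n)) :
  0 <= frobenius A.
Proof. exact: sqrtr_ge0. Qed.

(** Lets bounds on column vectors, where the contraction rate lives, carry over to matrices. *)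
Lemma frobenius_sqr_col (R : realType) (m n : nat) (A : 'M[R]_(m, n)) :
  frobenius A ^+ 2 = \sum_j frobenius (col j A) ^+ 2.
Proof.
have sqr p q (B : 'M[R]_(p, q)) :
    frobenius B ^+ 2 = \sum_i \sum_j B i j ^+ 2.
  by rewrite sqr_sqrtr//; do 2!apply: sumr_ge0 => ? _; exact: sqr_ge0.
rewrite sqr exchange_big; apply: eq_bigr => j _; rewrite sqr.
by apply: eq_bigr => i _; rewrite big_ord1 mxE.
Qed.

(* The infimum over an empty set is 0, so positivity of the rate says that some
   constant is admissible. *)
Lemma contraction_rate_le (R : realType) (N : nat) (W : 'M[R]_N)
    (v : 'cV[R]_N) :
  0 < contraction_rate W -> ones_orth v ->
  frobenius (W *m v) <= contraction_rate W * frobenius v.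
Proof.
rewrite /contraction_rate; set S := [set l | _] => S_gt0 v_orth.
have [l0 Sl0] : S !=set0.
  by apply/set0P/negP => /eqP S0; rewrite S0 inf0 ltxx in S_gt0.
(* If the norm of [v] vanishes, any admissible constant already makes the norm of [W *m v] vanish.
   Otherwise the quotient of the two norms is a lower bound of [S], hence at most its infimum. *)
have [v0|v_neq0] := eqVneq (frobenius v) 0.
  by have [_ /(_ v v_orth)] := Sl0; rewrite v0 !mulr0.
have v_gt0 : 0 < frobenius v by rewrite lt_neqAle eq_sym v_neq0 frobenius_ge0.
rewrite -ler_pdivrMr//; apply: lb_le_inf; first by exists l0.
by move=> l [_ /(_ v v_orth)]; rewrite ler_pdivrMr.
Qed.

(** Every column of [A] is orthogonal to the ones vector, so the vector bound applies column by
    column; the squares then add up. *)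
Lemma contraction_rate_le_mx (R : realType) (N d : nat) (W : 'M[R]_N)
    (A : 'M[R]_(N, d)) :
  0 < contraction_rate W -> (ones R N)^T *m A = 0 ->
  frobenius (W *m A) <= contraction_rate W * frobenius A.
Proof.
move=> lam_gt0 A_orth.
have rhs_ge0 : 0 <= contraction_rate W * frobenius A.
  by rewrite mulr_ge0 ?frobenius_ge0// ltW.
rewrite -(ler_pXn2r (n := 2)) ?nnegrE ?frobenius_ge0//.
rewrite exprMn !frobenius_sqr_col mulr_sumr; apply: ler_sum => j _.
have -> : col j (W *m A) = W *m col j A by rewrite !colE mulmxA.
have lam_ge0 := ltW lam_gt0.
rewrite -exprMn ler_pXn2r ?nnegrE ?mulr_ge0 ?frobenius_ge0//.
apply: contraction_rate_le => //.
by rewrite /ones_orth/= colE mulmxA A_orth mul0mx.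
Qed.

Lemma ones_mul_centering (R : realType) (N : nat) :
  (ones R N)^T *m centering R N = 0.
Proof.
(* For [N = 0] the factor [N%:R^-1] cannot cancel [N], but the product has no columns. *)
case: N => [|n]; first by rewrite thinmx0.
have ones_sqr : (ones R n.+1)^T *m ones R n.+1 = n.+1%:R%:M.
  apply/matrixP => i j; rewrite !mxE !ord1 eqxx.
  under eq_bigr do rewrite !mxE mulr1.
  by rewrite sumr_const card_ord.
rewrite mulmxBr mulmx1 -scalemxAr mulmxA ones_sqr mul_scalar_mx scalerA.
by rewrite mulVf ?pnatr_eq0// scale1r subrr.
Qed.

(** Row sums 1 mean that [W] fixes the ones vector, column sums 1 that its transpose does; hence
    multiplying the all-ones matrix by [W] on either side leaves it unchanged. *)
Lemma centering_commute (R : realType) (N : nat) (W : 'M[R]_N) :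
  doubly_stochastic W -> centering R N *m W = W *m centering R N.
Proof.
move=> [_ row_sum col_sum].
have W1 : W *m ones R N = ones R N.
  apply/matrixP => i j; rewrite !mxE -(row_sum i).
  by apply: eq_bigr => k _; rewrite mxE mulr1.
have oneW : (ones R N)^T *m W = (ones R N)^T.
  apply/matrixP => i j; rewrite !mxE -(col_sum j).
  by apply: eq_bigr => k _; rewrite !mxE mul1r.
rewrite mulmxBl mulmxBr mul1mx mulmx1 -scalemxAl -scalemxAr.
by rewrite -mulmxA oneW mulmxA W1.
Qed.

Lemma disagreement_ge0 (R : realType) (N d : nat) (X : 'M[R]_(N, d)) :
  0 <= disagreement X.
Proof. by rewrite mulr_ge0 ?frobenius_ge0// invr_ge0 sqrtr_ge0. Qed.

Lemma disagreement_mul_le (R : realType) (N d : nat) (W : 'M[R]_N)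
    (X : 'M[R]_(N, d)) :
  doubly_stochastic W -> 0 < contraction_rate W ->
  disagreement (W *m X) <= contraction_rate W * disagreement X.
Proof.
move=> W_ds lam_gt0; rewrite /disagreement mulmxA centering_commute//.
rewrite -mulmxA mulrCA ler_wpM2l ?invr_ge0 ?sqrtr_ge0//.
by apply: contraction_rate_le_mx => //; rewrite mulmxA ones_mul_centering mul0mx.
Qed.

Lemma le_nceil (R : realType) (x : R) : x <= (nceil x)%:R.
Proof.
rewrite /nceil pmulrn gez0_abs ?le_max ?lexx//.
by rewrite (le_trans (ceil_ge x))// ler_int le_max lexx orbT.
Qed.

Lemma expr_nceil_le (R : realType) (l x y : R) :
  0 < l -> l < 1 -> 0 < x -> 0 < y ->
  l ^+ nceil (ln (y / x) / ln l) * x <= y.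
Proof.
move=> l_gt0 l_lt1 x_gt0 y_gt0.
have yx_gt0 : 0 < y / x by rewrite divr_gt0.
have lnl_lt0 : ln l < 0 by rewrite ln_lt0// l_gt0.
(* Compare logarithms; dividing by the negative [ln l] reverses the inequality, so rounding up is
   the safe direction. *)
rewrite -ler_pdivlMr// -ler_ln ?posrE ?exprn_gt0// lnXn//.
by rewrite -mulr_natl -ler_ndivrMr// le_nceil.
Qed.

(** The recursion is assumed only below [n], because mode 1 is known to be active only on an initial
    stretch of rounds. *)
Lemma geometric_le (R : realType) (u : nat -> R) (l : R) (n : nat) :
  0 <= l -> (forall k, (k < n)%N -> u k.+1 <= l * u k) ->
  u n <= l ^+ n * u 0%N.
Proof.
move=> l_ge0; elim: n => [_|n IHn u_step]; first by rewrite mul1r.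
rewrite (le_trans (u_step n _))// exprS -mulrA ler_wpM2l// IHn// => k kn.
exact/u_step/ltnW.
Qed.

Lemma arithmetic_eq (R : realType) (u : nat -> R) (c : R) (n : nat) :
  (forall k, (k < n)%N -> u k.+1 = u k - c) -> u n = u 0%N - n%:R * c.
Proof.
elim: n => [_|n IHn u_step]; first by rewrite mul0r subr0.
rewrite u_step// IHn => [|k kn]; last exact/u_step/ltnW.
by rewrite -natr1 mulrDl mul1r opprD addrA.
Qed.

Theorem theorem2 (R : realType) (N d : nat)
    (W : mode -> 'M[R]_N) (lam c : mode -> R) (eta eps : R)
    (X : nat -> 'M[R]_(N, d)) (b : nat -> R)
    (W_ds : forall s, doubly_stochastic (W s))
    (lam_def : forall s, lam s = contraction_rate (W s))
    (lam_gt0 : forall s, 0 < lam s)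
    (lam_lt1 : forall s, lam s < 1)
    (c_gt0 : forall s, 0 < c s)
    (eta_gt0 : 0 < eta)
    (eps_gt0 : 0 < eps)
    (X_step : forall k, X k.+1 = W (switch eta (X k)) *m X k)
    (b_step : forall k, b k.+1 = b k - c (switch eta (X k)))
    (b0_gt0 : 0 < b 0%N)
    (cert : certificate_region lam c eta eps (X 0%N, b 0%N)) :
  [/\ exists2 k : nat,
        (k <= Kstar lam eta eps (disagreement (X 0%N)))%N
        & safe_set eps (X k, b k),
      disagreement (X (Kstar lam eta eps (disagreement (X 0%N)))) <= eps
    & c mode2 <= c mode1 ->
      0 <= b (Kstar lam eta eps (disagreement (X 0%N)))].
Proof.
have [_] := cert; rewrite /Bstar /Kstar /=.
pose D k := disagreement (X k); rewrite -/(D 0%N).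
set n1 := rounds1 _ _ _; set n2 := rounds2 _ _ _ => budget.
have D_step k : D k.+1 <= lam (switch eta (X k)) * D k.
  rewrite /D X_step lam_def; apply: disagreement_mul_le => //.
  by rewrite -lam_def.
have D_decr j k : (j <= k)%N -> D k <= D j.
  move=> jk; apply: (nonincreasing_seqP _).1 jk => n.
  by rewrite (le_trans (D_step n))// ler_piMl ?disagreement_ge0// ltW.
have mode1E k : eta < D k -> switch eta (X k) = mode1.
  by rewrite /switch -/(D k) => ->.
have mode2E k : D k <= eta -> switch eta (X k) = mode2.
  by rewrite /switch -/(D k) leNgt => /negbTE ->.
have Dn1 : D n1 <= eta.
  rewrite leNgt; apply/negP => eta_lt.
  (* The negated claim is put to use: by monotonicity it forces mode 1 in all rounds before [n1] and
     makes [D 0] positive, as the logarithmic bound requires. *)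
  suff : D n1 <= eta by rewrite leNgt eta_lt.
  have lt_D k : (k <= n1)%N -> eta < D k.
    by move=> /D_decr; exact: lt_le_trans.
  apply: (@le_trans _ _ (lam mode1 ^+ n1 * D 0%N)).
    apply: geometric_le => [|k kn1]; first exact: ltW.
    by rewrite -(mode1E k)// lt_D// ltnW.
  by apply: expr_nceil_le => //; rewrite (lt_trans eta_gt0)// lt_D.
(* [m] is the switching round, the first with disagreement at most [eta]. *)
have [m Dm m_min] := ex_minnP (ex_intro (fun k => D k <= eta) n1 Dn1).
have m_le : (m <= n1)%N by exact: m_min.
have D_m j : D (m + j)%N <= eta by rewrite (le_trans _ Dm)// D_decr// leq_addr.
have b_m : b m = b 0%N - m%:R * c mode1.
  apply: arithmetic_eq => k km; rewrite b_step mode1E// ltNge.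
  by apply/negP => /m_min; rewrite leqNgt km.
have b_mD j : b (m + j)%N = b 0%N - m%:R * c mode1 - j%:R * c mode2.
  rewrite -b_m -[in b m](addn0 m).
  apply: (@arithmetic_eq _ (fun i => b (m + i)%N)) => k _.
  by rewrite addnS b_step mode2E.
have D_eps : D (m + n2)%N <= eps.
  apply: (@le_trans _ _ (lam mode2 ^+ n2 * D (m + 0)%N)).
    apply: (@geometric_le _ (fun i => D (m + i)%N)) => [|k _]; first exact: ltW.
    by rewrite addnS -(mode2E (m + k)%N).
  (* [n2] is computed from the worst case, in which the second phase starts exactly at [eta]. *)
  apply: (@le_trans _ _ (lam mode2 ^+ n2 * eta)); last exact: expr_nceil_le.
  by rewrite ler_wpM2l// exprn_ge0// ltW.
have mn2_le : (m + n2 <= n1 + n2)%N by rewrite leq_add2r.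
split.
- exists (m + n2)%N => //; split => //=.
  rewrite b_mD -addrA -opprD subr_ge0 (le_trans _ budget)//.
  by rewrite lerD2r ler_wpM2r ?ler_nat// ltW.
- exact: le_trans (D_decr _ _ mn2_le) D_eps.
- move=> c21; have -> : (n1 + n2 = m + ((n1 - m) + n2))%N.
    by rewrite addnA subnKC.
  rewrite b_mD -addrA -opprD subr_ge0 (le_trans _ budget)//.
  (* Cancelling the [n2] rounds of mode 2 and the [m] rounds of mode 1 leaves the cost of [n1 - m]
     rounds in either mode. *)
  rewrite natrD mulrDl addrA lerD2r -[in leRHS](subnKC m_le) natrD mulrDl.
  by rewrite lerD2l ler_wpM2l.
Qed.
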